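(* Let $\Lambda\subseteq\mathbb H$ be an axially symmetric open set, and let $\mathbf i,\mathbf j\in\mathbb S^2$ with $\mathbf i\perp\mathbf j$. 1. Let $f\in\mathcal H(\Lambda)$. Then there exist four functions $h_\ell\in Hol_c(\Lambda_{\mathbf i})$, $\ell=0,\dots,3$, such that $$f|_{\Lambda_{\mathbf i}}=h_0+h_1\mathbf i+h_2\mathbf j+h_3\mathbf i\mathbf j .$$ 2. With respect to the basis $\{1,\mathbf i,\mathbf j,\mathbf i\mathbf j\}$ of $\mathbb H$, $$\mathcal H(\Lambda)=\mathcal H_c(\Lambda)\oplus\mathcal H_c(\Lambda)\,\mathbf i\oplus\mathcal H_c(\Lambda)\,\mathbf j\oplus\mathcal H_c(\Lambda)\,\mathbf i\mathbf j$$ (direct sum of real vector spaces).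
   Context: $\mathbb H$ is the algebra of quaternions and $\mathbb S^2$ is the sphere of purely imaginary unit quaternions. For $\mathbf i\in\mathbb S^2$, $\mathbb C(\mathbf i)$ is the real span of $\{1,\mathbf i\}$ (a copy of $\mathbb C$) and $\Lambda_{\mathbf i}=\Lambda\cap\mathbb C(\mathbf i)$. A set $\Lambda\subseteq\mathbb H$ is axially symmetric if $x+I_qy\in\Lambda$ ($x,y\in\mathbb R$, $I_q\in\mathbb S^2$) implies $x+Iy\in\Lambda$ for all $I\in\mathbb S^2$. $\mathcal H(\Lambda)$ is the set of functions $f:\Lambda\to\mathbb H$ of the form $f(x+Iy)=\alpha(x,y)+I\beta(x,y)$ for all $I\in\mathbb S^2$, $x+Iy\in\Lambda$, where $\alpha,\beta$ are $\mathbb H$-valued, real differentiable, independent of $I$, satisfy $\alpha(x,-y)=\alpha(x,y)$, $\beta(x,-y)=-\beta(x,y)$, and the Cauchy-Riemann system $\frac{\partial\alpha}{\partial x}-\frac{\partial\beta}{\partial y}=0$, $\frac{\partial\alpha}{\partial y}+\frac{\partial\beta}{\partial x}=0$. $\mathcal H_c(\Lambda)$ is the set of $f\in\mathcal H(\Lambda)$ satisfying the C-property $f(q)=\overline{f(\bar q)}$ for all $q\in\Lambda$ (quaternionic conjugation), and $\mathcal H_c(\Lambda)a=\{fa:f\in\mathcal H_c(\Lambda)\}$. $Hol_c(\Lambda_{\mathbf i})$ is the set of holomorphic $h:\Lambda_{\mathbf i}\to\mathbb C(\mathbf i)$ with $h(\bar z)=\overline{h(z)}$ for all $z\in\Lambda_{\mathbf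 i}$. *)

(* Defs.v *)
From HB Require Import structures.
From mathcomp Require Import all_boot all_order all_algebra.
From mathcomp Require Import all_classical all_reals all_analysis.
From mathcomp Require Import ring lra.

Set Implicit Arguments.
Unset Strict Implicit.
Unset Printing Implicit Defensive.

Import Order.TTheory GRing.Theory Num.Theory.
Import numFieldNormedType.Exports.

Local Open Scope classical_set_scope.
Local Open Scope ring_scope.

Record quat (R : realType) : Type :=
  Quat { qre : R; qim1 : R; qim2 : R; qim3 : R }.

Section Quaternions.
Variable R : realType.

Definition quat_tuple (q : quat R) : R * R * R * R :=
  (qre q, qim1 q, qim2 q, qim3 q).

Definition tuple_quat (t : R * R * R * R) : quat R :=
  Quat t.1.1.1 t.1.1.2 t.1.2 t.2.

Lemma quat_tupleK : cancel quat_tuple tuple_quat.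
Proof. by case. Qed.

HB.instance Definition _ := Choice.copy (quat R) (can_type quat_tupleK).

Implicit Types p q : quat R.

Lemma quatP p q : qre p = qre q -> qim1 p = qim1 q -> qim2 p = qim2 q ->
  qim3 p = qim3 q -> p = q.
Proof. by case: p q => [? ? ? ?] [? ? ? ?] /= -> -> -> ->. Qed.

Definition qzero : quat R := Quat 0 0 0 0.

Definition qopp q : quat R := Quat (- qre q) (- qim1 q) (- qim2 q) (- qim3 q).

Definition qadd p q : quat R :=
  Quat (qre p + qre q) (qim1 p + qim1 q) (qim2 p + qim2 q) (qim3 p + qim3 q).

Lemma qaddA : associative qadd.
Proof. by move=> p q r; apply: quatP => /=; ring. Qed.

Lemma qaddC : commutative qadd.
Proof. by move=> p q; apply: quatP => /=; ring. Qed.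

Lemma qadd0q : left_id qzero qadd.
Proof. by move=> q; apply: quatP => /=; ring. Qed.

Lemma qaddNq : left_inverse qzero qopp qadd.
Proof. by move=> q; apply: quatP => /=; ring. Qed.

HB.instance Definition _ :=
  GRing.isZmodule.Build (quat R) qaddA qaddC qadd0q qaddNq.

Definition qscale (k : R) q : quat R :=
  Quat (k * qre q) (k * qim1 q) (k * qim2 q) (k * qim3 q).

Lemma qscaleA k l q : qscale k (qscale l q) = qscale (k * l) q.
Proof. by apply: quatP => /=; ring. Qed.

Lemma qscale1 : left_id 1 qscale.
Proof. by move=> q; apply: quatP => /=; ring. Qed.

Lemma qscaleDr : right_distributive qscale +%R.
Proof. by move=> k p q; apply: quatP => /=; ring. Qed.

Lemma qscaleDl q : {morph qscale^~ q : k l / k + l}.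
Proof. by move=> k l; apply: quatP => /=; ring. Qed.

HB.instance Definition _ := GRing.Zmodule_isLmodule.Build R (quat R)
  qscaleA qscale1 qscaleDr qscaleDl.

Definition qone : quat R := Quat 1 0 0 0.

Definition qmul p q : quat R := Quat
  (qre p * qre q - qim1 p * qim1 q - qim2 p * qim2 q - qim3 p * qim3 q)
  (qre p * qim1 q + qim1 p * qre q + qim2 p * qim3 q - qim3 p * qim2 q)
  (qre p * qim2 q - qim1 p * qim3 q + qim2 p * qre q + qim3 p * qim1 q)
  (qre p * qim3 q + qim1 p * qim2 q - qim2 p * qim1 q + qim3 p * qre q).

Lemma qmulA : associative qmul.
Proof. by move=> p q r; apply: quatP => /=; ring. Qed.

Lemma qmul1q : left_id qone qmul.
Proof. by move=> q; apply: quatP => /=; ring. Qed.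

Lemma qmulq1 : right_id qone qmul.
Proof. by move=> q; apply: quatP => /=; ring. Qed.

Lemma qmulDl : left_distributive qmul +%R.
Proof. by move=> p q r; apply: quatP => /=; ring. Qed.

Lemma qmulDr : right_distributive qmul +%R.
Proof. by move=> p q r; apply: quatP => /=; ring. Qed.

Lemma qone_neq0 : qone != 0.
Proof. by apply/eqP => -[] /eqP; rewrite oner_eq0. Qed.

HB.instance Definition _ := GRing.Zmodule_isNzRing.Build (quat R)
  qmulA qmul1q qmulq1 qmulDl qmulDr qone_neq0.

Lemma qscaleAl (k : R) p q : k *: (p * q) = (k *: p) * q.
Proof. by apply: quatP => /=; ring. Qed.

HB.instance Definition _ := GRing.Lmodule_isLalgebra.Build R (quat R) qscaleAl.

Lemma qscaleAr (k : R) p q : k *: (p * q) = p * (k *: q).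
Proof. by apply: quatP => /=; ring. Qed.

HB.instance Definition _ := GRing.Lalgebra_isAlgebra.Build R (quat R) qscaleAr.

Definition qconj q : quat R := Quat (qre q) (- qim1 q) (- qim2 q) (- qim3 q).

Definition qdot p q : R :=
  qre p * qre q + qim1 p * qim1 q + qim2 p * qim2 q + qim3 p * qim3 q.

Lemma qdot_ge0 q : 0 <= qdot q q.
Proof. by rewrite /qdot -!expr2 !addr_ge0 // sqr_ge0. Qed.

Lemma qdot_eq0 q : (qdot q q == 0) = (q == 0).
Proof.
apply/eqP/eqP => [|->]; last by rewrite /qdot /=; ring.
by rewrite /qdot => h; apply: quatP => /=; nra.
Qed.

Lemma qdot_CauchySchwarz p q : qdot p q ^+ 2 <= qdot p p * qdot q q.
Proof.
rewrite -subr_ge0.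
have -> : qdot p p * qdot q q - qdot p q ^+ 2 =
    (qre p * qim1 q - qim1 p * qre q) ^+ 2 +
    (qre p * qim2 q - qim2 p * qre q) ^+ 2 +
    (qre p * qim3 q - qim3 p * qre q) ^+ 2 +
    (qim1 p * qim2 q - qim2 p * qim1 q) ^+ 2 +
    (qim1 p * qim3 q - qim3 p * qim1 q) ^+ 2 +
    (qim2 p * qim3 q - qim3 p * qim2 q) ^+ 2 by rewrite /qdot; ring.
by rewrite !addr_ge0 // sqr_ge0.
Qed.

Definition qnorm q : R := Num.sqrt (qdot q q).

Lemma ler_qnormD p q : qnorm (p + q) <= qnorm p + qnorm q.
Proof.
have n0 r : 0 <= qnorm r by exact: sqrtr_ge0.
rewrite -(ger0_norm (addr_ge0 (n0 p) (n0 q))) -sqrtr_sqr ler_sqrt ?sqr_ge0 //.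
rewrite sqrrD !sqr_sqrtr ?qdot_ge0 //.
have -> : qdot (p + q) (p + q) = qdot p p + qdot p q *+ 2 + qdot q q.
  by rewrite /qdot /=; ring.
rewrite lerD2r lerD2l lerMn2r /= (le_trans (ler_norm _)) //.
rewrite -sqrtr_sqr -sqrtrM ?qdot_ge0 // ler_sqrt ?mulr_ge0 ?qdot_ge0 //.
exact: qdot_CauchySchwarz.
Qed.

Lemma qnormZ (k : R) q : qnorm (k *: q) = `|k| * qnorm q.
Proof.
rewrite /qnorm -sqrtr_sqr -sqrtrM ?sqr_ge0 //; congr Num.sqrt.
by rewrite /qdot /=; ring.
Qed.

Lemma qnorm0_eq0 q : qnorm q = 0 -> q = 0.
Proof.
move=> /eqP; rewrite sqrtr_eq0 => q0; apply/eqP; rewrite -qdot_eq0.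
by rewrite eq_le q0 qdot_ge0.
Qed.

HB.instance Definition _ :=
  Lmodule_isNormed.Build R (quat R) ler_qnormD qnormZ qnorm0_eq0.

Definition qinv q : quat R := (qdot q q)^-1 *: qconj q.

Definition qunit : pred (quat R) := fun q => q != 0.

Lemma qmulVq : {in qunit, left_inverse 1 qinv *%R}.
Proof.
move=> q; rewrite unfold_in -qdot_eq0 => q0; rewrite /qinv -scalerAl.
have -> : qconj q * q = qdot q q *: 1 by apply: quatP => /=; rewrite /qdot; ring.
by rewrite scalerA mulVf // scale1r.
Qed.

Lemma qmulqV : {in qunit, right_inverse 1 qinv *%R}.
Proof.
move=> q; rewrite unfold_in -qdot_eq0 => q0; rewrite /qinv -scalerAr.
have -> : q * qconj q = qdot q q *: 1 by apply: quatP => /=; rewrite /qdot; ring.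
by rewrite scalerA mulVf // scale1r.
Qed.

Lemma qunitP p q : q * p = 1 /\ p * q = 1 -> qunit p.
Proof.
move=> [qp _]; apply/eqP => p0; move: qp; rewrite p0 mulr0 => /esym/eqP.
by rewrite oner_eq0.
Qed.

Lemma qinv0id : {in [predC qunit], qinv =1 id}.
Proof.
move=> q; rewrite inE unfold_in negbK => /eqP ->.
by apply: quatP => /=; ring.
Qed.

HB.instance Definition _ :=
  GRing.NzRing_hasMulInverse.Build (quat R) qmulVq qmulqV qunitP qinv0id.

End Quaternions.

Section SliceRegular.
Variable R : realType.
Implicit Types (Lambda A : set (quat R)) (i : quat R).

Definition qsphere : set (quat R) := [set q | qre q = 0 /\ `|q| = 1].

Definition slice_plane i : set (quat R) :=
  [set q | exists x y : R, q = x%:A + y *: i].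

Definition slice Lambda i : set (quat R) := Lambda `&` slice_plane i.

Definition axially_symmetric Lambda : Prop :=
  forall (x y : R) (I : quat R), qsphere I -> Lambda (x%:A + y *: I) ->
  forall J : quat R, qsphere J -> Lambda (x%:A + y *: J).

Definition slice_domain Lambda : set (R * R) :=
  [set p | exists2 I, qsphere I & Lambda (p.1%:A + p.2 *: I)].

(* alpha and beta are total, but are only constrained on slice_domain Lambda;
   this set is open when Lambda is open, so that differentiability and partial
   derivatives at its points do not depend on the values outside it. *)
Definition slice_regular Lambda : set (Lambda -> quat R) :=
  [set f | exists alpha beta : R * R -> quat R,
    [/\ forall (q : Lambda) (x y : R) (I : quat R), qsphere I ->
          val q = x%:A + y *: I -> f q = alpha (x, y) + I * beta (x, y),
        forall p, slice_domain Lambda p ->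
          differentiable alpha p /\ differentiable beta p,
        forall x y, slice_domain Lambda (x, y) ->
          alpha (x, - y) = alpha (x, y) /\ beta (x, - y) = - beta (x, y) &
        forall p, slice_domain Lambda p ->
          'D_(1, 0) alpha p - 'D_(0, 1) beta p = 0 /\
          'D_(0, 1) alpha p + 'D_(1, 0) beta p = 0]].

(* For axially symmetric Lambda every q in Lambda has its conjugate p in
   Lambda. *)
Definition slice_regular_c Lambda : set (Lambda -> quat R) :=
  [set f | @slice_regular Lambda f /\
    forall q p : Lambda, val p = qconj (val q) -> f q = qconj (f p)].

Definition slice_regular_c_mul Lambda (a : quat R) : set (Lambda -> quat R) :=
  [set (fun q => f q * a) | f in @slice_regular_c Lambda].

(* Complex differentiability inside slice_plane i, at all points of A. The
   extension 'valL_ 0 h of h by 0 outside A plays no role when A is relatively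
   open in slice_plane i, as slice Lambda i is for open Lambda. *)
Definition holomorphic_in i A (h : A -> quat R) : Prop :=
  forall z : A, exists2 l, slice_plane i l &
    ('valL_ 0 h (val z + w) - h z) * w^-1
      @[w --> within (slice_plane i) (0 : quat R)^'] --> l.

Definition Hol_c Lambda i : set (slice Lambda i -> quat R) :=
  [set h | [/\ forall z, slice_plane i (h z),
               holomorphic_in i h &
               forall z w, val w = qconj (val z) -> h w = qconj (h z)]].

End SliceRegular.

Arguments qsphere R : clear implicits.
Arguments slice_regular {R} Lambda.
Arguments slice_regular_c {R} Lambda.
Arguments slice_regular_c_mul {R} Lambda a.
Arguments Hol_c {R} Lambda i.

(* S is the internal direct sum of the linear subspaces T k of V. *)
Definition is_direct_sum (R : realType) (V : lmodType R) (n : nat)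
    (S : set V) (T : 'I_n -> set V) : Prop :=
  [/\ forall k, submod_closed (mem (T k)),
      S = [set v | exists2 t : 'I_n -> V,
                     forall k, T k (t k) & v = \sum_(k < n) t k] &
      forall t : 'I_n -> V, (forall k, T k (t k)) ->
        \sum_(k < n) t k = 0 -> forall k, t k = 0].

(* Main.v *)
Require Import Defs.
From HB Require Import structures.
From mathcomp Require Import all_boot all_order all_algebra.
From mathcomp Require Import all_classical all_reals all_analysis.
From mathcomp Require Import ring lra.
Import Order.TTheory GRing.Theory Num.Theory.
Import numFieldNormedType.Exports.
Local Open Scope classical_set_scope.
Local Open Scope ring_scope.

(** A slice regular function has the form f (x + I y) = alpha (x, y) +
    I beta (x, y), where I multiplies from the left. Expanding the values of
    alpha and beta in the orthonormal basis e = (1, i, j, i j) with the real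
    coefficients on the left of the e_k gives
      f = sum_k (alpha_k + I beta_k) e_k    with alpha_k, beta_k real valued.
    Taking a coefficient is a bounded real linear map, so it preserves
    differentiability, parity and the Cauchy-Riemann system; each f_k =
    alpha_k + I beta_k is therefore slice regular.

    The link with the C-property is that it characterizes the functions
    having real valued alpha and beta (slice_regular_cP). If alpha and beta are
    real, conjugation replaces I by - I, in agreement with f (x - I y).
    Conversely, the C-property says alpha + J beta = conj (alpha - J beta) for
    every unit imaginary J, since by axial symmetry the whole sphere x + J y
    lies in the domain, and this forces alpha and beta to be real
    (qreal_C_property). So the expansion above expresses f in the
    four summands (slice_regular_expansion). Conversely right multiplication by
    a constant preserves slice regularity, so the summands are subspaces of the
    slice regular functions. The sum is direct (slice_regular_c_free) because
    sum_k f_k e_k = 0 reads A + J B = 0 on a sphere, for quaternions A and B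
    with coordinates alpha_k and beta_k; taking J = I and J = - I gives
    A = B = 0.

    For the first part, restrict the f_k to the plane C(i). With alpha and beta
    real, the function alpha + i beta takes its values in C(i) and its real
    differential is multiplication by the partial derivative l = alpha_x +
    i beta_x, by the Cauchy-Riemann system (stem_complex_diff). Since the
    quaternion norm is multiplicative, the first order Taylor estimate divided
    by the norm of w says that the difference quotients tend to l
    (holomorphic_restriction). *)

Set Implicit Arguments.
Unset Strict Implicit.
Unset Printing Implicit Defensive.

(** * Norm, imaginary units and axial coordinates of quaternions *)

Section QuaternionAlgebra.
Variable R : realType.
Implicit Types p q a I : quat R.

Lemma sqr_qnorm q : `|q| ^+ 2 = qdot q q.
Proof. by rewrite /Num.norm /= /qnorm sqr_sqrtr ?qdot_ge0. Qed.

Lemma qnormM p q : `|p * q| = `|p| * `|q|.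
Proof.
rewrite /Num.norm /= /qnorm -sqrtrM ?qdot_ge0 //; congr Num.sqrt.
by rewrite /qdot /=; ring.
Qed.

Lemma norm_qdot p q : `|qdot p q| <= `|p| * `|q|.
Proof.
rewrite -sqrtr_sqr /Num.norm /= /qnorm -sqrtrM ?qdot_ge0 //.
by rewrite ler_sqrt ?mulr_ge0 ?qdot_ge0 // qdot_CauchySchwarz.
Qed.

Lemma qnorm1 : `|1 : quat R| = 1.
Proof.
have -> : `|1 : quat R| = Num.sqrt (1 ^+ 2).
  by rewrite /Num.norm /= /qnorm; congr Num.sqrt; rewrite /qdot /=; ring.
by rewrite sqrtr_sqr normr1.
Qed.

Lemma qsphereP I : qsphere R I <-> qre I = 0 /\ qdot I I = 1.
Proof.
split=> -[I0 I1]; split=> //; first by rewrite -sqr_qnorm I1 expr1n.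
by rewrite /Num.norm /= /qnorm I1 sqrtr1.
Qed.

Lemma qsphereN I : qsphere R I -> qsphere R (- I).
Proof. by case=> I0 I1; split; rewrite ?normrN //= I0 oppr0. Qed.

Lemma qsphere_sqr I : qsphere R I -> I * I = - 1.
Proof.
case/qsphereP; case: I => x0 x1 x2 x3; rewrite /qdot /= => -> h.
by apply: quatP => /=; rewrite -?h; ring.
Qed.

Lemma qreE q x y I : qsphere R I -> q = x%:A + y *: I -> qre q = x.
Proof. by case=> I0 _ ->; rewrite /= I0; ring. Qed.

Lemma qconj_axial x y I : qsphere R I ->
  qconj (x%:A + y *: I) = x%:A + y *: - I.
Proof. by case=> I0 _; apply: quatP => /=; rewrite ?I0; ring. Qed.

(** The unit I is the direction of the imaginary part; on the real axis, where
    there is no direction, any unit will do. *)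
Lemma axial_form q :
  exists x y I, qsphere R I /\ q = x%:A + y *: I.
Proof.
have [v [v0 qE]] : exists v, qre v = 0 /\ q = (qre q)%:A + v.
  by exists (q - (qre q)%:A); split; [rewrite /=; ring|rewrite addrC subrK].
have [v_eq0|vn0] := eqVneq v 0.
  exists (qre q), 0, (Quat 0 1 0 0); split; last by rewrite scale0r {1}qE v_eq0.
  by apply/qsphereP; split=> //; rewrite /qdot /=; ring.
exists (qre q), `|v|, (`|v|^-1 *: v); split.
  by split; [rewrite /= v0 mulr0|rewrite normrZV ?unitfE ?normr_eq0].
by rewrite scalerA divff ?normr_eq0 // scale1r.
Qed.

End QuaternionAlgebra.

(** * Orthonormal bases of the quaternions *)

Section OrthonormalBases.
Variable R : realType.
Implicit Types p q : quat R.

Definition qcoord (c : 'I_4) (q : quat R) : R :=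
  tnth [tuple qre q; qim1 q; qim2 q; qim3 q] c.

Lemma qcoordP p q : (forall c, qcoord c p = qcoord c q) -> p = q.
Proof.
move=> h; apply: quatP; [move: (h 0)|move: (h 1)|move: (h 2%:R)|
  move: (h 3%:R)]; by rewrite /qcoord !(tnth_nth 0).
Qed.

Lemma qdotE p q : qdot p q = \sum_c qcoord c p * qcoord c q.
Proof.
by rewrite !big_ord_recl big_ord0 /qcoord !(tnth_nth 0) /= /qdot; ring.
Qed.

Lemma qcoordD c p q : qcoord c (p + q) = qcoord c p + qcoord c q.
Proof. by case: c => -[|[|[|[|//]]]] ?; rewrite /qcoord !(tnth_nth 0). Qed.

Lemma qcoordZ c (k : R) q : qcoord c (k *: q) = k * qcoord c q.
Proof. by case: c => -[|[|[|[|//]]]] ?; rewrite /qcoord !(tnth_nth 0). Qed.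

Lemma qcoord_sum c n (F : 'I_n -> quat R) :
  qcoord c (\sum_k F k) = \sum_k qcoord c (F k).
Proof.
apply: (big_morph (qcoord c)); first exact: qcoordD.
by case: c => -[|[|[|[|//]]]] ?; rewrite /qcoord !(tnth_nth 0).
Qed.

Definition qorthonormal (e : 'I_4 -> quat R) :=
  forall k l, qdot (e k) (e l) = (k == l)%:R.

(** Completeness comes from linear algebra: the matrix M of coordinates of an
    orthonormal family satisfies M M^T = 1, hence also M^T M = 1, which is the
    expansion formula read coordinatewise. *)
Lemma qorthonormal_expansion e : qorthonormal e ->
  forall q, \sum_k qdot q (e k) *: e k = q.
Proof.
move=> eON q; pose M := \matrix_(k, c) qcoord c (e k).
have MM : M *m M^T = 1%:M.
  apply/matrixP => k l; rewrite !mxE -eON qdotE.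
  by apply: eq_bigr => c _; rewrite !mxE.
apply: qcoordP => d; rewrite qcoord_sum.
under eq_bigr do rewrite qcoordZ qdotE mulr_suml.
rewrite exchange_big /=.
transitivity (\sum_c qcoord c q * (M^T *m M) c d).
  apply: eq_bigr => c _; rewrite mxE mulr_sumr; apply: eq_bigr => k _.
  by rewrite !mxE mulrA.
rewrite (mulmx1C MM) (bigD1 d) //= mxE eqxx mulr1 big1 ?addr0 // => c cd.
by rewrite mxE (negPf cd) mulr0.
Qed.

Lemma qdotZl (k : R) p q : qdot (k *: p) q = k * qdot p q.
Proof. by rewrite /qdot /=; ring. Qed.

Lemma qdot_suml n (F : 'I_n -> quat R) q :
  qdot (\sum_k F k) q = \sum_k qdot (F k) q.
Proof.
by elim/big_rec2: _ => [|k x p _ <-]; rewrite /qdot /=; ring.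
Qed.

Lemma qorthonormal_free e : qorthonormal e ->
  forall c : 'I_4 -> R, \sum_k c k *: e k = 0 -> forall k, c k = 0.
Proof.
move=> eON c sum0 l.
have : qdot (\sum_k c k *: e k) (e l) = c l.
  rewrite qdot_suml (bigD1 l) //= big1 ?addr0 => [|k kl];
    by rewrite qdotZl eON ?eqxx ?(negPf kl) ?mulr1 ?mulr0.
by rewrite sum0 => <-; rewrite /qdot /=; ring.
Qed.

(** For imaginary i and j the product i j is their cross product, up to the
    real part, which is - qdot i j and vanishes here. *)
Lemma qorthonormal_1ij (i j : quat R) : qsphere R i -> qsphere R j ->
  qdot i j = 0 -> qorthonormal (tnth [tuple 1; i; j; i * j]).
Proof.
move=> /qsphereP[i0 i1] /qsphereP[j0 j1] ij0.
have ij1 : qdot (i * j) (i * j) = 1.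
  by rewrite -sqr_qnorm qnormM exprMn !sqr_qnorm i1 j1 mulr1.
have dotC p q : qdot p q = qdot q p by rewrite /qdot; ring.
have one_one : qdot (1 : quat R) 1 = 1 by rewrite /qdot /=; ring.
have one_i : qdot 1 i = 0 by rewrite /qdot /= i0; ring.
have one_j : qdot 1 j = 0 by rewrite /qdot /= j0; ring.
have one_ij : qdot 1 (i * j) = 0.
  by rewrite -[RHS]oppr0 -ij0 /qdot /= i0 j0; ring.
have i_ij : qdot i (i * j) = 0 by rewrite /qdot /= i0 j0; ring.
have j_ij : qdot j (i * j) = 0 by rewrite /qdot /= i0 j0; ring.
move=> [[|[|[|[|//]]]] ?] [[|[|[|[|//]]]] ?];
  by rewrite !(tnth_nth 0) -val_eqE /= // dotC.
Qed.

End OrthonormalBases.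

(** * Real differentials and bounded linear maps *)

Section BoundedLinear.
Variables (R : realType) (U V W : normedModType R).

Lemma lipschitz_linear_continuous (L : {linear V -> W}) (C : R) :
  (forall v, `|L v| <= C * `|v|) -> continuous L.
Proof.
move=> LC; apply/linear_bounded_continuous/linear_boundedP.
apply: filterS (nbhs_pinfty_ge (num_real C)) => r Cr v.
by apply: le_trans (LC v) _; exact: ler_wpM2r.
Qed.

(** This makes the coefficient maps and the multiplications by a constant act
    on stem pairs. *)
Lemma bounded_linear_comp (L : {linear V -> W}) (C : R) (f : U -> V) (p : U) :
    (forall v, `|L v| <= C * `|v|) -> differentiable f p ->
  differentiable (L \o f) p /\ forall u, 'D_u (L \o f) p = L ('D_u f p).
Proof.
move=> /lipschitz_linear_continuous Lc df.
have dL : differentiable L (f p) by exact: linear_differentiable.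
have dLf : differentiable (L \o f) p by exact: differentiable_comp.
split=> // u; rewrite (deriveE u dLf) (deriveE u df) (diff_comp df dL) /=.
by rewrite (diff_lin _ Lc).
Qed.

End BoundedLinear.

Section Differentials.
Variable R : realType.

(** The little-o expansion in epsilon-delta form, which can be transported to
    increments w of a slice plane by comparing norms. *)
Lemma differentiable_estimate (V W : normedModType R) (G : V -> W) (p : V)
    (e : R) : differentiable G p -> 0 < e ->
  exists2 d : R, 0 < d & forall u, `|u| < d ->
    `|G (p + u) - (G p + 'd G p u)| <= e * `|u|.
Proof.
move=> /diff_locally /eqaddoP oG e0.
have /nbhs_norm0P[d /= d0 dG] := oG _ e0.
by exists d => // u ud; have := dG _ ud; rewrite !fctE /= [u + p]addrC.
Qed.

Lemma diff_pair (W : normedModType R) (G : R * R -> W) (p : R * R) x y :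
  differentiable G p ->
  'd G p (x, y) = x *: 'D_(1, 0) G p + y *: 'D_(0, 1) G p.
Proof.
move=> dG; rewrite !(deriveE _ dG) -!linearZ -linearD; congr ('d G p _).
by congr (_, _); rewrite /= /GRing.scale /= ?mulr1 ?mulr0 ?addr0 ?add0r.
Qed.

Lemma valL_in (T : Type) (V : Type) (v : V) (A : set T) (h : A -> V) (x : T)
    (Ax : A x) : 'valL_ v h x = h (SigSub (mem_set Ax)).
Proof. by rewrite -[in RHS](valLK v h). Qed.

End Differentials.

(** * Stem pairs (alpha, beta) and the functions they induce *)

Section Stems.
Variable R : realType.
Implicit Types (Lambda : set (quat R)) (q a i I : quat R).
Implicit Types (alpha beta : R * R -> quat R).

Definition qmull a q := a * q.
Definition qmulr a q := q * a.
(** The coefficient of q along a, seen as a real quaternion rather than as a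
    real number so that it can be composed with stem pairs. *)
Definition qproj a q : quat R := (qdot q a)%:A.

Lemma qmull_is_linear a : linear (qmull a).
Proof. by move=> k p q; rewrite /qmull mulrDr scalerAr. Qed.
HB.instance Definition _ a := GRing.isLinear.Build R (quat R) (quat R) _
  (qmull a) (qmull_is_linear a).

Lemma qmulr_is_linear a : linear (qmulr a).
Proof. by move=> k p q; rewrite /qmulr mulrDl scalerAl. Qed.
HB.instance Definition _ a := GRing.isLinear.Build R (quat R) (quat R) _
  (qmulr a) (qmulr_is_linear a).

Lemma qproj_is_linear a : linear (qproj a).
Proof. by move=> k p q; apply: quatP; rewrite /qproj /qdot /=; ring. Qed.
HB.instance Definition _ a := GRing.isLinear.Build R (quat R) (quat R) _
  (qproj a) (qproj_is_linear a).

Definition qbounded (L : quat R -> quat R) :=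
  exists C, forall q, `|L q| <= C * `|q|.

Lemma qmull_bounded a : qbounded (qmull a).
Proof. by exists `|a| => q; rewrite qnormM. Qed.

Lemma qmulr_bounded a : qbounded (qmulr a).
Proof. by exists `|a| => q; rewrite qnormM mulrC. Qed.

Lemma qproj_bounded a : qbounded (qproj a).
Proof.
by exists `|a| => q; rewrite normrZ qnorm1 mulr1 mulrC norm_qdot.
Qed.

Definition qreal q := q = (qre q)%:A.

Lemma qreal_proj a q : qreal (qproj a q).
Proof. by apply: quatP => /=; ring. Qed.

Lemma qproj1 q : qproj 1 q = (qre q)%:A.
Proof. by apply: quatP; rewrite /qproj /qdot /=; ring. Qed.

(** The hypothesis is the C-property on a sphere x + I y. Comparing coordinates
    for I = e_1 kills the imaginary part of a and the e_1-coordinate of b; the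
    other two coordinates of b vanish by taking I = e_2 and I = e_3. *)
Lemma qreal_C_property a b :
    (forall I, qsphere R I -> a + I * b = qconj (a - I * b)) ->
  qreal a /\ qreal b.
Proof.
move=> h.
have S1 : qsphere R (Quat 0 1 0 0).
  by apply/qsphereP; split=> //; rewrite /qdot /=; ring.
have S2 : qsphere R (Quat 0 0 1 0).
  by apply/qsphereP; split=> //; rewrite /qdot /=; ring.
have S3 : qsphere R (Quat 0 0 0 1).
  by apply/qsphereP; split=> //; rewrite /qdot /=; ring.
move: (h _ S1) (h _ S2) (h _ S3); case: a b {h} => a0 a1 a2 a3 [b0 b1 b2 b3].
by case=> ? ? ? ? [] ? ? ? ? [] ? ? ? ?; split; apply: quatP => /=; lra.
Qed.

(** The conditions on (alpha, beta) in the definition of slice regularity that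
    do not mention f. *)
Definition stem Lambda alpha beta := [/\
  forall p, slice_domain Lambda p ->
    differentiable alpha p /\ differentiable beta p,
  forall x y, slice_domain Lambda (x, y) ->
    alpha (x, - y) = alpha (x, y) /\ beta (x, - y) = - beta (x, y) &
  forall p, slice_domain Lambda p ->
    'D_(1, 0) alpha p - 'D_(0, 1) beta p = 0 /\
    'D_(0, 1) alpha p + 'D_(1, 0) beta p = 0].

Definition induced_by Lambda alpha beta (f : Lambda -> quat R) :=
  forall (q : Lambda) (x y : R) (I : quat R), qsphere R I ->
    val q = x%:A + y *: I -> f q = alpha (x, y) + I * beta (x, y).

Lemma slice_regularP Lambda (f : Lambda -> quat R) :
  slice_regular Lambda f <->
  exists alpha beta, stem Lambda alpha beta /\ induced_by alpha beta f.
Proof.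
split=> [[al [be [h1 h2 h3 h4]]]|[al [be [[h2 h3 h4] h1]]]]; exists al, be.
  by split.
by split.
Qed.

Lemma stem_comp Lambda alpha beta (L : {linear quat R -> quat R}) :
  qbounded L -> stem Lambda alpha beta ->
  stem Lambda (L \o alpha) (L \o beta).
Proof.
move=> [C LC] [sd sp sCR]; split=> [p Dp|x y Dxy|p Dp].
- have [da db] := sd _ Dp.
  by split; [have [] := bounded_linear_comp LC da|
    have [] := bounded_linear_comp LC db].
- by have [/= -> ->] := sp _ _ Dxy; rewrite linearN.
- have [da db] := sd _ Dp; have [e1 e2] := sCR _ Dp.
  have [_ Da] := bounded_linear_comp LC da.
  have [_ Db] := bounded_linear_comp LC db.
  by rewrite !Da !Db -linearB -linearD e1 e2 linear0.
Qed.

Lemma stem0 Lambda : stem Lambda 0 0.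
Proof.
have D0 (v p : R * R) : 'D_v (0 : R * R -> quat R) p = 0 by exact: derive_cst.
split=> [p _|x y _|p _]; first by split; exact: differentiable_cst.
  by split=> //; exact/esym/oppr0.
by rewrite !D0 subr0 addr0.
Qed.

Lemma stemD Lambda (a1 b1 a2 b2 : R * R -> quat R) :
  stem Lambda a1 b1 -> stem Lambda a2 b2 -> stem Lambda (a1 + a2) (b1 + b2).
Proof.
move=> [d1 p1 c1] [d2 p2 c2]; split=> [p Dp|x y Dxy|p Dp].
- by have [? ?] := d1 _ Dp; have [? ?] := d2 _ Dp; split;
    exact: differentiableD.
- have [e1 e2] := p1 _ _ Dxy; have [e3 e4] := p2 _ _ Dxy.
  by rewrite !fctE e1 e2 e3 e4 opprD.
- have [da1 db1] := d1 _ Dp; have [da2 db2] := d2 _ Dp.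
  rewrite !deriveD; try exact: diff_derivable.
  have [e1 e2] := c1 _ Dp; have [e3 e4] := c2 _ Dp.
  split; first by rewrite opprD addrACA e1 e3 addr0.
  by rewrite addrACA e2 e4 addr0.
Qed.

Lemma induced0 Lambda : induced_by 0 0 (0 : Lambda -> quat R).
Proof. by move=> q x y I _ _; apply/esym; rewrite [LHS]add0r [LHS]mulr0. Qed.

(** The function induced by a stem pair, written without choosing a
    representation of q: the ordinate y is taken to be the norm of the
    imaginary part v, and I to be v / |v|. On the real axis the inverse of 0 is
    0, which drops the beta term; this is right because beta is odd in y. *)
Definition axial alpha beta q :=
  let v := q - (qre q)%:A in
  alpha (qre q, `|v|) + (`|v|^-1 *: v) * beta (qre q, `|v|).

(** Independence of the representation x + y I: for y < 0 the formula for axial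
    uses the pair (- y, - I), and the parities of alpha and beta compensate. *)
Lemma axialE Lambda alpha beta x y I : stem Lambda alpha beta ->
  qsphere R I -> Lambda (x%:A + y *: I) ->
  axial alpha beta (x%:A + y *: I) = alpha (x, y) + I * beta (x, y).
Proof.
move=> [_ parity _] SI Lq; have Dxy : slice_domain Lambda (x, y) by exists I.
have [ea eb] := parity _ _ Dxy.
have vE : x%:A + y *: I - x%:A = y *: I by rewrite addrC addKr.
rewrite /axial (qreE SI erefl) vE.
have -> : `|y *: I| = `|y| by case: SI => _ I1; rewrite normrZ I1 mulr1.
case: (ltrgt0P y) => [y0|y0|y0].
- by rewrite scalerA mulVf ?scale1r // gt_eqF.
- rewrite ea eb scalerA invrN mulNr mulVf ?lt_eqF //.
  by rewrite scaleN1r mulNr mulrN opprK.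
- rewrite y0 scale0r scaler0 mul0r addr0.
  (* Oddness gives beta (x, 0) = - beta (x, 0). *)
  suff -> : beta (x, 0) = 0 by rewrite mulr0 addr0.
  move: eb; rewrite y0 oppr0 => /eqP; rewrite -addr_eq0 -mulr2n.
  by rewrite -scaler_nat scaler_eq0 pnatr_eq0 /= => /eqP.
Qed.

Lemma axial_induced Lambda alpha beta : stem Lambda alpha beta ->
  induced_by alpha beta (fun q : Lambda => axial alpha beta (val q)).
Proof.
move=> st q x y I SI qE; rewrite qE; apply: (axialE st) => //.
by rewrite -qE; exact: set_valP.
Qed.

(** The C-property forces the values of the stem pair to be real on the slice
    domain only. Replacing alpha and beta by their real parts changes nothing
    there and gives a pair that is real everywhere, so that its derivatives are
    real without further argument. *)
Lemma slice_regular_cP Lambda (f : Lambda -> quat R) :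
  axially_symmetric Lambda ->
  slice_regular_c Lambda f <-> exists alpha beta,
    [/\ stem Lambda alpha beta, induced_by alpha beta f,
        forall p, qreal (alpha p) & forall p, qreal (beta p)].
Proof.
move=> sym; split=> [[/slice_regularP[al [be [st ind]]] fC]|].
  exists (qproj 1 \o al), (qproj 1 \o be); split.
  - exact/stem_comp/st/qproj_bounded.
  - move=> q x y I SI qE.
    have Lq : Lambda (x%:A + y *: I) by rewrite -qE; exact: set_valP.
    suff [ra rb] : qreal (al (x, y)) /\ qreal (be (x, y)).
      by rewrite /= !qproj1 -ra -rb; exact: ind.
    apply: qreal_C_property => J SJ.
    have LJ := sym _ _ _ SI Lq _ SJ; have SNJ := qsphereN SJ.
    have LNJ := sym _ _ _ SI Lq _ SNJ.
    rewrite -mulNr.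
    rewrite -(ind (SigSub (mem_set LJ)) _ _ _ SJ erefl).
    rewrite -(ind (SigSub (mem_set LNJ)) _ _ _ SNJ erefl).
    by apply: fC => /=; rewrite qconj_axial.
  - by move=> p; exact: qreal_proj.
  - by move=> p; exact: qreal_proj.
move=> [al [be [st ind ra rb]]]; split.
  by apply/slice_regularP; exists al, be.
move=> q p pq; have [x [y [I [SI qE]]]] := axial_form (val q).
rewrite (ind _ _ _ _ SI qE).
have pE : val p = x%:A + y *: - I by rewrite pq qE qconj_axial.
rewrite (ind _ _ _ _ (qsphereN SI) pE) ra rb.
by case: SI => I0 _; apply: quatP => /=; rewrite ?I0; ring.
Qed.

End Stems.

(** * The direct sum decomposition *)

Section DirectSum.
Variable R : realType.
Implicit Types (Lambda : set (quat R)) (a i I : quat R).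
Implicit Types (alpha beta : R * R -> quat R).

Lemma slice_regular0 Lambda : slice_regular Lambda 0.
Proof.
by apply/slice_regularP; exists 0, 0; split; [exact: stem0|exact: induced0].
Qed.

Lemma slice_regularD Lambda (f g : Lambda -> quat R) :
  slice_regular Lambda f -> slice_regular Lambda g ->
  slice_regular Lambda (f + g).
Proof.
move=> /slice_regularP[a1 [b1 [s1 i1]]] /slice_regularP[a2 [b2 [s2 i2]]].
apply/slice_regularP; exists (a1 + a2), (b1 + b2); split; first exact: stemD.
move=> q x y I SI qE.
by rewrite !fctE (i1 _ _ _ _ SI qE) (i2 _ _ _ _ SI qE) mulrDr addrACA.
Qed.

(** I acts from the left on beta, so a right factor passes to the stem pair. *)
Lemma slice_regular_mulr Lambda (f : Lambda -> quat R) a :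
  slice_regular Lambda f -> slice_regular Lambda (fun q => f q * a).
Proof.
move=> /slice_regularP[al [be [st ind]]]; apply/slice_regularP.
exists (qmulr a \o al), (qmulr a \o be); split.
  exact/stem_comp/st/qmulr_bounded.
by move=> q x y I SI qE; rewrite (ind _ _ _ _ SI qE) mulrDl -mulrA.
Qed.

Lemma slice_regular_c0 Lambda : slice_regular_c Lambda 0.
Proof.
split; first exact: slice_regular0.
by move=> q p _; apply: quatP => /=; rewrite ?oppr0.
Qed.

Lemma slice_regular_c_linear Lambda (c : R) (f g : Lambda -> quat R) :
  slice_regular_c Lambda f -> slice_regular_c Lambda g ->
  slice_regular_c Lambda (c *: f + g).
Proof.
move=> [rf cf] [rg cg]; split.
  apply: slice_regularD => //.
  have -> : c *: f = (fun q => f q * c%:A).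
    by apply/funext => q; rewrite -scalerAr mulr1.
  exact: slice_regular_mulr.
move=> q p pq; rewrite !fctE (cf _ _ pq) (cg _ _ pq).
by apply: quatP => /=; ring.
Qed.

Lemma slice_regular_c_mul_closed Lambda a :
  submod_closed (mem (slice_regular_c_mul Lambda a)).
Proof.
split=> [|c u v /set_mem[f fc <-] /set_mem[g gc <-]]; apply/mem_set.
  exists 0; first exact: slice_regular_c0.
  by apply/funext => q; apply: mul0r.
exists (c *: f + g); first exact: slice_regular_c_linear.
by apply/funext => q; rewrite !fctE mulrDl scalerAl.
Qed.

(** The components are induced by the real coefficients of alpha and beta. *)
Lemma slice_regular_expansion Lambda (e : 'I_4 -> quat R)
    (f : Lambda -> quat R) :
  axially_symmetric Lambda -> qorthonormal e -> slice_regular Lambda f ->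
  exists F : 'I_4 -> Lambda -> quat R,
    (forall k, slice_regular_c Lambda (F k)) /\
    f = \sum_k (fun q => F k q * e k).
Proof.
move=> sym eON /slice_regularP[al [be [st ind]]].
pose a k := qproj (e k) \o al; pose b k := qproj (e k) \o be.
have stk k : stem Lambda (a k) (b k) by exact/stem_comp/st/qproj_bounded.
exists (fun k q => axial (a k) (b k) (val q)); split.
  move=> k; apply/(slice_regular_cP _ sym); exists (a k), (b k); split => //.
  - exact: axial_induced.
  - by move=> p; exact: qreal_proj.
  - by move=> p; exact: qreal_proj.
apply/funext => q; rewrite fct_sumE.
have [x [y [I [SI qE]]]] := axial_form (val q).
rewrite (ind _ _ _ _ SI qE).
under eq_bigr => k _.
  rewrite (axial_induced (stk k) SI qE) mulrDl -mulrA /= /qproj.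
  rewrite -!scalerAl !mul1r.
  over.
rewrite big_split /= -mulr_sumr.
by rewrite !(qorthonormal_expansion eON).
Qed.

(** Real stem pairs turn the relation into A + J B = 0 on each sphere of
    Lambda, where the coordinates of A and B are the values of the pairs; A and
    B vanish since both J = I and J = - I are allowed. *)
Lemma slice_regular_c_free Lambda (e : 'I_4 -> quat R)
    (F : 'I_4 -> Lambda -> quat R) :
  axially_symmetric Lambda -> qorthonormal e ->
  (forall k, slice_regular_c Lambda (F k)) ->
  \sum_k (fun q => F k q * e k) = 0 -> forall k, F k = 0.
Proof.
move=> sym eON Fc sum0.
have /choice[al /choice[be h]] : forall k, exists al be,
    [/\ stem Lambda al be, induced_by al be (F k),
        forall p, qreal (al p) & forall p, qreal (be p)].
  by move=> k; exact/(slice_regular_cP _ sym).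
move=> k; apply/funext => q.
have [x [y [I [SI qE]]]] := axial_form (val q).
have Lq : Lambda (x%:A + y *: I) by rewrite -qE; exact: set_valP.
pose A := \sum_k qre (al k (x, y)) *: e k.
pose B := \sum_k qre (be k (x, y)) *: e k.
have AB J : qsphere R J -> A + J * B = 0.
  move=> SJ; have LJ := sym _ _ _ SI Lq _ SJ.
  have /(congr1 (@^~ (SigSub (mem_set LJ)))) := sum0.
  rewrite fct_sumE => s0; apply: etrans s0.
  rewrite mulr_sumr -big_split; apply: eq_bigr => l _ /=.
  have [_ ind ra rb] := h l.
  rewrite (ind (SigSub (mem_set LJ)) _ _ _ SJ erefl) mulrDl.
  by rewrite [in RHS]ra [in RHS]rb -mulrA -!(scalerAl _ 1) !mul1r.
have [eA eB] : A = 0 /\ B = 0.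
  have AIB : A = I * B.
    by apply/eqP; rewrite -subr_eq0 -mulNr; apply/eqP/AB/qsphereN.
  have IB : I * B = 0.
    apply/eqP; have /eqP : I * B + I * B = 0 by rewrite -{1}AIB AB.
    by rewrite -mulr2n -scaler_nat scaler_eq0 pnatr_eq0.
  split; first by rewrite AIB.
  by apply: oppr_inj; rewrite oppr0 -mulN1r -(qsphere_sqr SI) -mulrA IB mulr0.
have [_ ind ra rb] := h k.
rewrite (ind _ _ _ _ SI qE) ra rb.
rewrite (qorthonormal_free eON eA k) (qorthonormal_free eON eB k).
by rewrite !scale0r mulr0 addr0.
Qed.

End DirectSum.

(** * Restriction to a slice is holomorphic *)

Section Holomorphy.
Variable R : realType.
Implicit Types (Lambda : set (quat R)) (a i I : quat R).
Implicit Types (alpha beta : R * R -> quat R).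

(** A real valued alpha is fixed by the bounded linear projection onto the real
    quaternions, which commutes with derivatives. *)
Lemma derive_qreal alpha p v : (forall p, qreal (alpha p)) ->
  differentiable alpha p -> qreal ('D_v alpha p).
Proof.
move=> ra da; have [C LC] := qproj_bounded (1 : quat R).
have [_ /(_ v) D] := bounded_linear_comp LC da.
have E : qproj 1 \o alpha = alpha.
  by apply/funext => u; rewrite /= qproj1 -ra.
by rewrite E in D; rewrite D; exact: qreal_proj.
Qed.

(** The Cauchy-Riemann system makes the partial derivative of alpha + i beta
    along y equal to i times the one along x. As alpha and beta are real, l lies
    in the plane of i and commutes with x + y i; this is why l may be written
    on the left, as the difference quotients (h (z + w) - h z) w^-1 require. *)
Lemma stem_complex_diff Lambda alpha beta i p : qsphere R i ->
    stem Lambda alpha beta -> slice_domain Lambda p ->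
    (forall p, qreal (alpha p)) -> (forall p, qreal (beta p)) ->
  let G := alpha + (qmull i \o beta) in
  differentiable G p /\
  exists2 l, slice_plane i l &
    forall x y, 'd G p (x, y) = l * (x%:A + y *: i).
Proof.
move=> Si [sd _ sCR] Dp ra rb G.
have [da db] := sd _ Dp; have [CR1 CR2] := sCR _ Dp.
have [C LC] := qmull_bounded i.
have [dib Dib] := bounded_linear_comp LC db.
have dG : differentiable G p by exact: differentiableD.
split=> //; pose ax := 'D_(1, 0) alpha p; pose bx := 'D_(1, 0) beta p.
have rax : qreal ax by exact: derive_qreal.
have rbx : qreal bx by exact: derive_qreal.
exists (ax + i * bx).
  exists (qre ax), (qre bx); rewrite rax rbx.
  by rewrite -scalerAr mulr1 /=; congr (_ *: _ + _ *: _); ring.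
move=> x y; rewrite (diff_pair _ _ dG) !deriveD; try exact: diff_derivable.
rewrite !Dib /qmull.
have -> : 'D_(0, 1) alpha p = - bx by apply/eqP; rewrite -addr_eq0 CR2.
have -> : 'D_(0, 1) beta p = ax by apply/esym/eqP; rewrite -subr_eq0 CR1.
rewrite -/ax -/bx rax rbx; have ii := qsphere_sqr Si.
rewrite -!(scalerAr _ i) !mulr1 !mulrDr !mulrDl.
rewrite -!scalerAr -!scalerAl !mulr1 !mul1r ii.
by apply: quatP => /=; ring.
Qed.

(** R * R carries the maximum norm, which is not the norm of the slice plane;
    this bound carries a Taylor estimate from R * R over to the plane. *)
Lemma slice_norm_le i (x y : R) : qsphere R i ->
  `|(x, y)| <= `|x%:A + y *: i|.
Proof.
move=> Si; have [i0 _] := Si; have [_ ii] := (qsphereP i).1 Si.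
have xE : x = qdot (x%:A + y *: i) 1 by rewrite /qdot /= i0; ring.
have yE : y = qdot (x%:A + y *: i) i.
  by rewrite -[LHS]mulr1 -ii /qdot /= i0; ring.
have [_ i1] := Si; rewrite prod_normE ge_max /=; apply/andP; split.
  by rewrite {1}xE (le_trans (norm_qdot _ _)) // qnorm1 mulr1.
by rewrite {1}yE (le_trans (norm_qdot _ _)) // i1 mulr1.
Qed.

Definition slice_incl Lambda i (z : slice Lambda i) : Lambda :=
  SigSub (mem_set (set_valP z).1).

(** Openness of Lambda keeps z + w in the domain for small w; the difference
    quotient minus l is then the Taylor remainder divided by w. *)
Lemma holomorphic_restriction Lambda i (f : Lambda -> quat R) :
  axially_symmetric Lambda -> open Lambda -> qsphere R i ->
  slice_regular_c Lambda f -> holomorphic_in i (f \o @slice_incl Lambda i).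
Proof.
move=> sym oL Si /(slice_regular_cP _ sym)[al [be [st ind ra rb]]] z.
have [Lz [x [y zE]]] := set_valP z.
have Dp : slice_domain Lambda (x, y) by exists i => //; rewrite -zE.
have [dG [l il dGE]] := stem_complex_diff Si st Dp ra rb.
set G := al + _ in dG dGE.
have fG u v (q : Lambda) : val q = u%:A + v *: i -> f q = G (u, v).
  by move=> /(ind _ _ _ _ Si) ->.
exists l => //; apply/cvgrPdist_le => e e0.
have [d d0 Gd] := differentiable_estimate dG e0.
have /nbhs_normP[r /= r0 rL] : nbhs (val z) Lambda by exact: open_nbhs_nbhs.
apply/nbhs_norm0P; exists (Num.min d r) => /=; first by rewrite lt_min d0.
move=> w /=; rewrite lt_min => /andP[wd wr] w0 iw.
have [u [v wE]] := iw.
have zwE : val z + w = (x + u)%:A + (y + v) *: i.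
  by rewrite zE wE !scalerDl addrACA.
have Azw : slice Lambda i (val z + w).
  by split; [apply: rL; rewrite /= opprD addNKr normrN|exists (x + u), (y + v)].
have /= -> := valL_in 0 (f \o @slice_incl Lambda i) Azw.
rewrite (fG (x + u) (y + v)) // (fG x y) //.
have wU : w \is a GRing.unit by [].
have lE : l = l * w * w^-1 by rewrite mulrK.
(* l - (G (p + w) - G p) / w = (l w - (G (p + w) - G p)) / w, and the norm of
   the quotient is the quotient of the norms. *)
rewrite {1}lE -mulrBl qnormM -normrN opprB.
rewrite -(ler_pM2r (_ : 0 < `|w|)) ?normr_gt0 //.
rewrite -mulrA -qnormM mulVr // qnorm1 mulr1.
have := Gd (u, v); rewrite dGE -wE => /(_ _) Guv.
have uvw : `|(u, v)| <= `|w| by rewrite wE slice_norm_le.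
rewrite -addrA -opprD (le_trans (Guv _)) ?(le_lt_trans uvw) //.
by rewrite ler_wpM2l // ltW.
Qed.

Lemma Hol_c_restriction Lambda i (f : Lambda -> quat R) :
  axially_symmetric Lambda -> open Lambda -> qsphere R i ->
  slice_regular_c Lambda f -> Hol_c Lambda i (f \o @slice_incl Lambda i).
Proof.
move=> sym oL Si fc; split; last first.
- move=> z w wz; apply: fc.2 => /=; rewrite wz.
  by apply: quatP => /=; rewrite ?opprK.
- exact: holomorphic_restriction.
- move=> z; have /(slice_regular_cP _ sym)[al [be [_ ind ra rb]]] := fc.
  have [_ [x [y zE]]] := set_valP z.
  exists (qre (al (x, y))), (qre (be (x, y))).
  by rewrite /= (ind _ x y i) // {1}ra {1}rb -scalerAr mulr1.
Qed.

End Holomorphy.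

Unset Implicit Arguments.

Theorem proposition3p15 (R : realType) (Lambda : set (quat R)) (i j : quat R)
    (Lambda_sym : axially_symmetric Lambda) (Lambda_open : open Lambda)
    (hi : qsphere R i) (hj : qsphere R j) (hij : qdot i j = 0) :
  (forall f : Lambda -> quat R, slice_regular Lambda f ->
     exists h0 h1 h2 h3 : slice Lambda i -> quat R,
       [/\ Hol_c Lambda i h0, Hol_c Lambda i h1,
           Hol_c Lambda i h2, Hol_c Lambda i h3 &
           forall (q : Lambda) (z : slice Lambda i), val q = val z ->
             f q = h0 z + h1 z * i + h2 z * j + h3 z * (i * j)])
  /\
  is_direct_sum (slice_regular Lambda)
    (fun k : 'I_4 =>
       slice_regular_c_mul Lambda (tnth [tuple 1; i; j; i * j] k)).
Proof.
have eON := qorthonormal_1ij hi hj hij; split=> [f fr|].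
  have [F [Fc fE]] := slice_regular_expansion Lambda_sym eON fr.
  exists (F ord0 \o @slice_incl R Lambda i), (F 1 \o @slice_incl R Lambda i),
    (F 2%:R \o @slice_incl R Lambda i), (F 3%:R \o @slice_incl R Lambda i).
  split; try exact: Hol_c_restriction.
  move=> q z qz; have -> : q = slice_incl z by exact: val_inj.
  rewrite fE fct_sumE !big_ord_recr big_ord0 /= add0r !(tnth_nth 0) /= mulr1.
  by congr (F _ _ + F _ _ * _ + F _ _ * _ + F _ _ * _); apply: val_inj.
split.
- by move=> k; exact: slice_regular_c_mul_closed.
- apply/seteqP; split=> [f fr|f [t tT ->]].
    have [F [Fc fE]] := slice_regular_expansion Lambda_sym eON fr.
    by eexists; last exact: fE; move=> k; exists (F k).
  elim/big_ind: _ => [||k _]; first exact: slice_regular0.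
    by move=> g h; exact: slice_regularD.
  by have [g [gr _] <-] := tT k; exact: slice_regular_mulr.
- move=> t tT sum0 k.
  have /choice[F FE] : forall k, exists F : Lambda -> quat R,
      slice_regular_c Lambda F /\
      (fun q => F q * tnth [tuple 1; i; j; i * j] k) = t k.
    by move=> l; have [F Fc <-] := tT l; exists F.
  have F0 : F k = 0.
    apply: (slice_regular_c_free Lambda_sym eON) => [l|]; first by case: (FE l).
    by rewrite -[RHS]sum0; apply: eq_bigr => l _; case: (FE l).
  by case: (FE k) => _ <-; rewrite F0; apply/funext => q; exact: mul0r.
Qed.
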